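(* Let $H=H(x,r,p):\mathbb{T}^n\times\mathbb{R}\times\mathbb{R}^n\to\mathbb{R}$ be continuous. Assume that: (i) there exists a constant $C_1>0$ such that $|H(x,r,p)-H(x,s,p)|\le C_1|r-s|$ for all $(x,p)\in\mathbb{T}^n\times\mathbb{R}^n$ and $r,s\in\mathbb{R}$; (ii) $\lim_{|p|\to\infty}H(x,0,p)=+\infty$ uniformly for $x\in\mathbb{T}^n$. Assume further that there exist $c\in\mathbb{R}$ and $\psi,\varphi\in\mathrm{Lip}(\mathbb{T}^n)$ such that $\psi\le\varphi$ and $\psi$, $\varphi$ are respectively a viscosity subsolution and a viscosity supersolution to $$H(x,u,Du)=c\quad\text{in }\mathbb{T}^n .$$ Then, for this same $c$, the equation $H(x,u,Du)=c$ in $\mathbb{T}^n$ has a viscosity solution $u\in\mathrm{Lip}(\mathbb{T}^n)$.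
   Context: $\mathbb{T}^n=\mathbb{R}^n/\mathbb{Z}^n$ is the flat $n$-dimensional torus, $\mathrm{Lip}(\mathbb{T}^n)$ is the set of Lipschitz functions on $\mathbb{T}^n$, and $Du$ is the spatial gradient of $u$. Sub/supersolutions and solutions are in the viscosity sense (Crandall–Lions). *)

(* Defs.v *)
From HB Require Import structures.
From mathcomp Require Import all_boot all_order all_algebra generic_quotient.
From mathcomp Require Import all_classical all_reals all_analysis.

Set Implicit Arguments.
Unset Strict Implicit.
Unset Printing Implicit Defensive.

Import Order.TTheory GRing.Theory Num.Theory.
Import numFieldTopology.Exports numFieldNormedType.Exports.

Local Open Scope classical_set_scope.
Local Open Scope ring_scope.
Local Open Scope quotient_scope.

Section torus.
Variables (R : realType) (n : nat).

Definition int_equiv (x y : 'rV[R]_n) : bool :=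
  [forall i, (x - y) ord0 i \is a Num.int].

Lemma int_equiv_refl : reflexive int_equiv.
Proof. by move=> x; apply/forallP => i; rewrite subrr mxE int_num0. Qed.

Lemma int_equiv_sym : symmetric int_equiv.
Proof.
move=> x y; apply/forallP/forallP => h i; move: (h i);
by rewrite -(opprB _ (_ : 'rV_n)) mxE rpredN.
Qed.

Lemma int_equiv_trans : transitive int_equiv.
Proof.
move=> y x z /forallP hxy /forallP hyz; apply/forallP => i.
by rewrite -(subrKA y) mxE rpredD.
Qed.

Definition int_equiv_rel : equiv_rel 'rV[R]_n :=
  EquivRel int_equiv int_equiv_refl int_equiv_sym int_equiv_trans.

Definition torus : Type := quotient_topology {eq_quot int_equiv_rel}.

HB.instance Definition _ := Quotient.on torus.
HB.instance Definition _ := Topological.on torus.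

(* The norm `|x| of MathComp-Analysis on 'rV[R]_n is the max norm. *)
Definition enorm (x : 'rV[R]_n) : R := Num.sqrt (\sum_i x ord0 i ^+ 2).

Definition torus_dist (x y : torus) : R :=
  inf [set r | exists a b : 'rV[R]_n,
                 [/\ \pi_torus a = x, \pi_torus b = y & r = enorm (a - b)]].

Definition Lip (u : torus -> R) : Prop :=
  exists L : R, forall x y, `|u x - u y| <= L * torus_dist x y.

Definition grad (f : 'rV[R]_n -> R) (x : 'rV[R]_n) : 'rV[R]_n :=
  \row_i 'D_(delta_mx ord0 i) f x.

Definition torus_lift (f : torus -> R) : 'rV[R]_n -> R := f \o \pi_torus.

Definition C1 (f : torus -> R) : Prop :=
  (forall x, differentiable (torus_lift f) x) /\ continuous (grad (torus_lift f)).

(* The gradient of the lift is periodic, so the choice of representative is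
   immaterial. *)
Definition torus_grad (f : torus -> R) (x : torus) : 'rV[R]_n :=
  grad (torus_lift f) (repr x).

Definition viscosity_subsolution (H : torus -> R -> 'rV[R]_n -> R) (c : R)
    (u : torus -> R) : Prop :=
  continuous u /\
  forall (phi : torus -> R) (x : torus), C1 phi ->
    (\forall y \near x, u y - phi y <= u x - phi x) ->
    H x (u x) (torus_grad phi x) <= c.

Definition viscosity_supersolution (H : torus -> R -> 'rV[R]_n -> R) (c : R)
    (u : torus -> R) : Prop :=
  continuous u /\
  forall (phi : torus -> R) (x : torus), C1 phi ->
    (\forall y \near x, u x - phi x <= u y - phi y) ->
    c <= H x (u x) (torus_grad phi x).

Definition viscosity_solution (H : torus -> R -> 'rV[R]_n -> R) (c : R)
    (u : torus -> R) : Prop :=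
  viscosity_subsolution H c u /\ viscosity_supersolution H c u.

End torus.

(* Main.v *)
Require Import Defs.
From mathcomp Require Import all_boot all_order all_algebra generic_quotient.
From mathcomp Require Import all_classical all_reals all_analysis.
From mathcomp Require Import ring lra.
Import Order.TTheory GRing.Theory Num.Theory.
Import numFieldTopology.Exports numFieldNormedType.Exports.
Local Open Scope classical_set_scope.
Local Open Scope ring_scope.
Local Open Scope quotient_scope.

(* Perron's method. Let F be the set of subsolutions between psi and phi that are
   L-Lipschitz, and u its pointwise supremum. By coercivity and the Lipschitz
   bound in r, L can be chosen above every |p_i| with H(x,r,p) < c and
   psi x <= r <= phi x. Then u is a subsolution as a supremum. If u failed to be
   a supersolution at a point where u < phi, then max(u, g + delta), with g a
   strict test function from below, would still belong to F: where g + delta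
   exceeds u, it is a classical strict subsolution with gradient below L. Where
   u = phi, the supersolution property is inherited from phi. *)

(** * Compactness of the torus and descent of periodic functions to it *)

Section Torus.
Context {R : realType} {n : nat}.
Local Notation torus_pi := (\pi_(torus R n)).
Implicit Types (x y : torus R n) (f g : torus R n -> R) (a b : 'rV[R]_n).

Lemma torus_piP a b :
  torus_pi a = torus_pi b <-> forall i, (a - b) ord0 i \is a Num.int.
Proof.
split=> [/(@eqmodP _ (int_equiv_rel R n))/forallP //|h].
exact/(@eqmodP _ (int_equiv_rel R n))/forallP.
Qed.

(** The torus is the continuous image of the cube [K]: subtracting floors moves any representative
    into it. *)
Lemma torus_compact : compact [set: torus R n].
Proof.
pose K := [set v : 'rV[R]_n | forall i, `[0, 1]%classic (v ord0 i)].
have cK : compact K.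
  have := @rV_compact R n (fun=> `[0, 1]%classic); apply=> _; exact: segment_compact.
have -> : [set: torus R n] = torus_pi @` K.
  apply/seteqP; split=> // x _.
  exists (\row_i (repr x ord0 i - (Num.floor (repr x ord0 i))%:~R)).
    move=> i; rewrite /= mxE in_itv/=.
    have := floor_itv (repr x ord0 i); rewrite intrD; lra.
  rewrite -[RHS]reprK; apply/torus_piP => i.
  by rewrite !mxE addrAC subrr add0r rpredN intr_int.
apply: continuous_compact => //.
by apply: continuous_subspaceT; exact: pi_continuous.
Qed.

Lemma torus_continuousP {Z : topologicalType} (f : torus R n -> Z) :
  continuous f <-> continuous (f \o torus_pi).
Proof. exact: quotient_continuous. Qed.

Lemma torus_continuous_argmax f : continuous f -> exists x, forall y, f y <= f x.
Proof.
move=> cf.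
have [||x _ hx] := compact_EVT_max _ torus_compact (f := f).
- by exists (torus_pi 0).
- exact: continuous_subspaceT.
by exists x => y; apply: hx; rewrite inE.
Qed.

(* The choice of representative is junk unless [F] is periodic. *)
Definition torus_fun {T : Type} (F : 'rV[R]_n -> T) (x : torus R n) : T := F (repr x).

Definition int_periodic {T : Type} (F : 'rV[R]_n -> T) :=
  forall a b, (forall i, (a - b) ord0 i \is a Num.int) -> F a = F b.

Lemma torus_funE {T : Type} (F : 'rV[R]_n -> T) a :
  int_periodic F -> torus_fun F (torus_pi a) = F a.
Proof. by move=> pF; apply/pF/torus_piP; rewrite reprK. Qed.

Lemma torus_fun_lift F : int_periodic F -> torus_lift (torus_fun F) = F.
Proof. by move=> pF; apply/funext => a; exact: torus_funE. Qed.

Lemma torus_fun_continuous {Z : topologicalType} (F : 'rV[R]_n -> Z) :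
  int_periodic F -> continuous F -> continuous (torus_fun F).
Proof.
move=> pF cF; apply/torus_continuousP.
by rewrite (_ : _ \o _ = F)//; apply/funext => a; exact: torus_funE.
Qed.

(** Shifting the base point by an integer vector leaves every difference quotient of the lift
    unchanged. *)
Lemma grad_lift_periodic f : int_periodic (grad (torus_lift f)).
Proof.
move=> a b hab; apply/rowP => i; rewrite !mxE.
suff fE c : torus_lift f (c + a) = torus_lift f (c + b).
  rewrite /derive; set F := (X in lim (X @ _)); set G := (X in _ = lim (X @ _)).
  suff -> : F = G by [].
  apply/funext => h; rewrite /F /G /=.
  by rewrite fE -[X in _ - torus_lift f X]add0r fE add0r.
congr f; apply/torus_piP => j.
by rewrite opprD addrACA subrr add0r.
Qed.

Lemma torus_gradE f a : torus_grad f (torus_pi a) = grad (torus_lift f) a.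
Proof. exact/torus_funE/grad_lift_periodic. Qed.

Lemma torus_grad_continuous f : C1 f -> continuous (torus_grad f).
Proof.
by move=> [_ cf]; apply: torus_fun_continuous cf; exact: grad_lift_periodic.
Qed.

Lemma C1_continuous f : C1 f -> continuous f.
Proof.
move=> [df _]; apply/torus_continuousP => a.
exact/differentiable_continuous/df.
Qed.

End Torus.

Lemma row_continuous {T : topologicalType} {R : realType} {n : nat}
    (F : T -> 'rV[R]_n) :
  (forall i, continuous (fun x => F x ord0 i)) -> continuous F.
Proof.
move=> cF x A [P nP PA].
have : \forall y \near x, forall i, P ord0 i (F y ord0 i).
  by apply: filter_forall => i; exact: (cF i x _ (nP ord0 i)).
apply: filterS => y Py; apply: PA => i j.
by rewrite (ord1 i); exact: Py.
Qed.

(** * Gradients and first-order conditions on the torus *)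

Section Gradient.
Context {R : realType} {n : nat}.
Local Notation torus_pi := (\pi_(torus R n)).
Implicit Types (x y : torus R n) (f g : torus R n -> R) (a b : 'rV[R]_n).

(** The single shape [f + k * g + c] covers the differences, negations, vertical shifts and added
    bumps of test functions used below. *)
Lemma grad_comb f g (k c : R) a : C1 f -> C1 g ->
  grad (torus_lift (fun x => f x + k * g x + c)) a =
  grad (torus_lift f) a + k *: grad (torus_lift g) a.
Proof.
move=> [df _] [dg _]; apply/rowP => i; rewrite !mxE.
rewrite (_ : torus_lift _ = torus_lift f + k *: torus_lift g + cst c)//.
have df' : derivable (torus_lift f) a (delta_mx ord0 i) by exact: diff_derivable.
have dg' : derivable (torus_lift g) a (delta_mx ord0 i) by exact: diff_derivable.
have dkg : derivable (k *: torus_lift g) a (delta_mx ord0 i) by exact: derivableZ.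
rewrite deriveD ?derive_cst ?addr0; [|exact: derivableD|exact: derivable_cst].
by rewrite deriveD// deriveZ.
Qed.

Lemma C1_comb f g (k c : R) : C1 f -> C1 g -> C1 (fun x => f x + k * g x + c).
Proof.
move=> f1 g1; split=> [a|].
  have dkg : differentiable (k *: torus_lift g) a by apply: differentiableZ; exact: g1.1.
  have df : differentiable (torus_lift f) a by exact: f1.1.
  exact: (differentiableD (differentiableD df dkg) (differentiable_cst c a)).
apply: row_continuous => i.
rewrite (_ : (fun _ => _) = (fun a => grad (torus_lift f) a ord0 i) \+
    (k \*: (fun a => grad (torus_lift g) a ord0 i))); last first.
  by apply/funext => a; rewrite grad_comb// !mxE /= !mxE.
have cc h : C1 h -> continuous (fun a => grad (torus_lift h) a ord0 i).
  move=> [_ ch] a; have cco := @coord_continuous R 1 n ord0 i.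
  exact: (continuous_comp (ch a) (cco _)).
move=> a; apply: continuousD; first exact: cc.
exact/continuousZl_tmp/cc.
Qed.

Lemma torus_grad_comb f g (k c : R) x : C1 f -> C1 g ->
  torus_grad (fun x => f x + k * g x + c) x = torus_grad f x + k *: torus_grad g x.
Proof. exact: grad_comb. Qed.

Lemma is_derive_line (F : 'rV[R]_n -> R) a v (t : R) :
  differentiable F (a + t *: v) ->
  is_derive t 1 (fun s : R => F (a + s *: v)) ('D_v F (a + t *: v)).
Proof.
move=> dF; have dl : is_diff t (fun s : R => a + s *: v) (fun s => s *: v).
  have dv : is_diff t (fun s : R => s *: v) (fun s => s *: v) by exact: is_diff_scalel.
  have := is_diffD (is_diff_cst a t) dv.
  by rewrite add0r.
have dFl : differentiable (F \o (fun s => a + s *: v)) t.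
  by apply: differentiable_comp.
apply: DeriveDef; first exact/derivable1_diffP.
rewrite deriveE// -[X in 'd X _](_ : F \o (fun s => a + s *: v) = _)//.
by rewrite diff_comp// deriveE//= diff_val scale1r.
Qed.

Lemma derive_grad (F : 'rV[R]_n -> R) a v : differentiable F a ->
  'D_v F a = \sum_i v ord0 i * grad F a ord0 i.
Proof.
move=> dF; rewrite deriveE// {1}(row_sum_delta v) linear_sum/=.
by apply: eq_bigr => i _; rewrite linearZ/= mxE deriveE.
Qed.

(** Along each coordinate line through a representative of [x], the lift has a local maximum at
    parameter 0, so every partial derivative vanishes. *)
Lemma torus_grad_max0 f x : C1 f -> (\forall y \near x, f y <= f x) ->
  torus_grad f x = 0.
Proof.
move=> f1 fx; rewrite -[x]reprK torus_gradE; set a := repr x.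
apply/rowP => i; rewrite !mxE; set v := delta_mx _ _.
have ff (t : R) : is_derive t 1 (fun s : R => torus_lift f (a + s *: v))
    ('D_v (torus_lift f) (a + t *: v)).
  by apply: is_derive_line; exact: f1.1.
have : \forall t \near (0 : R), f (torus_pi (a + t *: v)) <= f x.
  have cl : {for 0, continuous (fun t : R => torus_pi (a + t *: v))}.
    apply: continuous_comp; last exact: pi_continuous.
    by apply: cvgD; [exact: cvg_cst|exact: scalel_continuous].
  have : nbhs (torus_pi (a + 0 *: v)) [set y | f y <= f x].
    by rewrite scale0r addr0 reprK.
  exact: cl.
move=> /nbhs_ballP[e /= e0 he].
have [||||_] := @derive1_at_max _ (fun s : R => torus_lift f (a + s *: v)) (- e) e 0.
- by rewrite ge0_cp ?ltW.
- by move=> t _; case: (ff t).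
- by rewrite in_itv/= oppr_lt0 e0.
- move=> t; rewrite in_itv/= => te; rewrite scale0r addr0 [in leRHS]/torus_lift/= reprK.
  by apply: he; rewrite /ball/= sub0r normrN ltr_norml.
by rewrite (@derive_val _ _ _ _ _ _ _ (ff 0)) scale0r addr0.
Qed.

Lemma torus_grad_touch f g x : C1 f -> C1 g ->
  (\forall y \near x, f y - g y <= f x - g x) -> torus_grad f x = torus_grad g x.
Proof.
move=> f1 g1 fg; apply/eqP; rewrite -subr_eq0 -scaleN1r; apply/eqP.
rewrite -(torus_grad_comb _ _ (- 1) 0)//; apply: torus_grad_max0.
  exact: C1_comb.
by apply: filterS fg => y; rewrite !mulN1r !addr0.
Qed.

End Gradient.

(** * A periodic C1 bump that vanishes at a single point *)

Section Bump.
Context {R : realType} {n : nat}.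
Local Notation torus_pi := (\pi_(torus R n)).
Implicit Types (x y : torus R n) (f g : torus R n -> R) (a b : 'rV[R]_n).

Lemma cos_int_periodic (t s : R) : t - s \is a Num.int ->
  cos (pi *+ 2 * t) = cos (pi *+ 2 * s).
Proof.
move=> /intrP[m ts]; have -> : t = s + m%:~R by rewrite -ts addrC subrK.
have nat_case (u : R) k : cos (pi *+ 2 * (u + k%:R)) = cos (pi *+ 2 * u).
  by rewrite mulrDr mulr_natr; exact: (periodicn (@cosD2pi R)).
case: m {ts} => m; first exact: nat_case.
by rewrite NegzE rmorphN/= -(nat_case _ m.+1) subrK.
Qed.

(** By periodicity only the fractional part [s] counts; the double-angle formula gives
    [sin (pi * s) = 0], impossible for [0 < s < 1]. *)
Lemma cos_eq1_int (t : R) : cos (pi *+ 2 * t) = 1 -> t \is a Num.int.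
Proof.
move=> ct; set s := t - (Num.floor t)%:~R.
have cs : cos (pi *+ 2 * s) = 1.
  rewrite -ct; apply: cos_int_periodic.
  by rewrite /s addrAC subrr add0r rpredN intr_int.
have /andP[s0 s1] : 0 <= s < 1.
  by have := floor_itv t; rewrite /s intrD; lra.
suff s00 : s = 0 by rewrite -[t](subrK (Num.floor t)%:~R) -/s s00 add0r intr_int.
apply/eqP; apply: contraT => sn0.
have sp : 0 < s by rewrite lt_neqAle eq_sym sn0.
have : 0 < sin (pi * s).
  apply: sin_gt0_pi; rewrite mulr_gt0 ?pi_gt0//=.
  by rewrite gtr_pMr ?pi_gt0.
have : sin (pi * s) ^+ 2 = 0.
  move: cs; rewrite mulrnAl cos_mulr2n cos2sin2 mulr2n; lra.
by move/eqP; rewrite sqrf_eq0 => /eqP ->; rewrite ltxx.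
Qed.

Lemma torus_grad_cst (k : R) x : torus_grad (fun=> k) x = 0.
Proof. by apply/rowP => i; rewrite !mxE derive_cst. Qed.

Lemma C1_cst (k : R) : C1 (fun _ : torus R n => k).
Proof.
split=> [a|]; first exact: differentiable_cst.
rewrite (_ : grad _ = cst 0); first exact: cst_continuous.
by apply/funext => a; apply/rowP => i; rewrite !mxE derive_cst.
Qed.

Definition cosbump_lift b a : R := \sum_i (1 - cos (pi *+ 2 * (a ord0 i - b ord0 i))).

Lemma cosbump_lift_periodic b : int_periodic (cosbump_lift b).
Proof.
move=> a c ac; apply: eq_bigr => i _; congr (1 - _); apply: cos_int_periodic.
by rewrite opprB addrA subrK; have := ac i; rewrite !mxE.
Qed.

(* Plays the role of |y - x|^2 as a penalization that lives on the torus. *)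
Definition cosbump x y : R := torus_fun (cosbump_lift (repr x)) y.

Lemma cosbump_ge0 x y : 0 <= cosbump x y.
Proof. by apply: sumr_ge0 => i _; rewrite subr_ge0 cos_le1. Qed.

Lemma cosbumpxx x : cosbump x x = 0.
Proof. by apply: big1 => i _; rewrite subrr mulr0 cos0 subrr. Qed.

Lemma cosbump_eq0 x y : cosbump x y = 0 -> y = x.
Proof.
move=> /eqP; rewrite psumr_eq0 => [/allP q0|i _]; last by rewrite subr_ge0 cos_le1.
rewrite -[y]reprK -[x]reprK; apply/torus_piP => i.
apply: cos_eq1_int; have := q0 i (mem_index_enum _).
by rewrite !mxE/= subr_eq0 => /eqP.
Qed.

Lemma cosbump_C1 x : C1 (cosbump x).
Proof.
rewrite /C1 (torus_fun_lift _ (cosbump_lift_periodic _)); set b := repr x.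
pose G i (s : R) : R := 1 - cos (pi *+ 2 * (s - b ord0 i)).
pose dG i (s : R) : R := pi *+ 2 * sin (pi *+ 2 * (s - b ord0 i)).
have dGE i (s : R) : is_derive s 1 (G i) (dG i s).
  apply: is_derive_eq; rewrite add0r mul1r subr0 /dG /GRing.scale/=; ring.
pose p i a : R := a ord0 i.
have QE : cosbump_lift b = \sum_(i < n) (G i \o p i).
  by apply/funext => a; rewrite fct_sumE.
have dp i a : differentiable (p i) a by exact: differentiable_coord.
have dGp i a : differentiable (G i \o p i) a.
  have dG1 : differentiable (G i) (p i a).
    by apply/derivable1_diffP; case: (dGE i (p i a)).
  exact: (differentiable_comp (dp i a) dG1).
split=> [a|]; first by rewrite QE; exact: differentiable_sum.
apply: row_continuous => i.
rewrite (_ : (fun _ => _) = dG i \o p i).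
  move=> a; apply: continuous_comp; first exact: coord_continuous.
  apply: (@continuousM _ _ (cst (pi *+ 2))); first exact: cst_continuous.
  apply: continuous_comp; last exact: continuous_sin.
  apply: (@continuousM _ _ (cst (pi *+ 2))); first exact: cst_continuous.
  by apply: continuousB => //; exact: cst_continuous.
apply/funext => a; rewrite /grad mxE QE derive_sum => [|j]; last exact: diff_derivable.
(* Along the [i]-th axis the [j]-th coordinate moves with speed [(i == j)%:R], so the chain rule
   kills every summand but the [i]-th. *)
have DG j : 'D_(delta_mx ord0 i) (G j \o p j) a = (i == j)%:R * dG j (p j a).
  set v := delta_mx ord0 i.
  have [] := @is_derive_line R n (G j \o p j) a v 0
    (ltac:(by rewrite scale0r addr0)).
  rewrite [in RHS]scale0r addr0 => _ <-.
  rewrite (_ : (fun s => _) = (fun s => G j (p j a + s * (i == j)%:R))).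
    have dline : is_derive (0 : R) 1 (fun s : R => p j a + s * (i == j)%:R) (i == j)%:R.
      by apply: is_derive_eq; rewrite add0r mul1r scaler0 add0r /GRing.scale/= mulr1.
    have dG0 : is_derive (p j a + 0 * (i == j)%:R) 1 (G j) (dG j (p j a)).
      by rewrite mul0r addr0.
    have [_ ->] := @is_derive1_comp R (G j) (fun s : R => p j a + s * (i == j)%:R) 0 _ _ dG0 dline.
    by rewrite mulrC.
  by apply/funext => s; rewrite /= /p !mxE eqxx andTb (eq_sym j).
rewrite (bigD1 i)//= big1 ?addr0 => [|j ji]; first by rewrite DG eqxx mul1r.
by rewrite DG eq_sym (negbTE ji) mul0r.
Qed.

Lemma cosbump_continuous x : continuous (cosbump x).
Proof. exact/C1_continuous/cosbump_C1. Qed.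

Lemma torus_grad_cosbump x : torus_grad (cosbump x) x = 0.
Proof.
rewrite -(torus_grad_cst (0 : R) x); apply/esym/torus_grad_touch.
- exact: C1_cst.
- exact: cosbump_C1.
by apply: (@nearW _ (nbhs x)) => y; rewrite cosbumpxx subr0 sub0r oppr_le0 cosbump_ge0.
Qed.

(** On the compact complement of the interior of [A] the bump attains a positive minimum, since it
    vanishes only at [x]; this minimum serves as [e]. If that complement is empty, any [e] works. *)
Lemma cosbump_nbhs x (A : set (torus R n)) : nbhs x A ->
  exists2 e : R, 0 < e & forall y, cosbump x y < e -> A y.
Proof.
move=> Ax; pose U := interior A; have oU : open U by exact: open_interior.
have UA : U `<=` A by exact: interior_subset.
have Ux : U x by exact: nbhs_singleton (nbhs_interior Ax).
have [U0|] := pselect (~` U !=set0); last first.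
  move=> h; exists 1 => // y _; apply: UA; apply: contrapT => nUy.
  by apply: h; exists y.
have cU : compact (~` U).
  by apply: (subclosed_compact _ torus_compact) => //; exact: open_closedC.
have [y /set_mem Uy hy] := compact_EVT_min U0 cU
  (continuous_subspaceT (cosbump_continuous x)).
exists (cosbump x y).
  rewrite lt_neqAle cosbump_ge0 andbT eq_sym; apply/eqP => /cosbump_eq0 yx.
  by apply: Uy; rewrite yx.
move=> z; apply: contra_ltP => nAz; apply: hy; apply/mem_set => /UA; exact: nAz.
Qed.

End Bump.

(** * Lipschitz bounds and their propagation along segments *)

Section Lipschitz.
Context {R : realType} {n : nat}.
Local Notation torus_pi := (\pi_(torus R n)).
Implicit Types (x y : torus R n) (f g u : torus R n -> R) (a b : 'rV[R]_n) (K L : R).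

(** The l1 norm is dual to the max norm: a bound [K] on every gradient coordinate gives the
    Lipschitz constant [K] with no dimensional factor. *)
Definition norm1 a : R := \sum_i `|a ord0 i|.

Lemma norm1_ge0 a : 0 <= norm1 a.
Proof. exact: sumr_ge0. Qed.

Lemma norm1N a : norm1 (- a) = norm1 a.
Proof. by apply: eq_bigr => i _; rewrite mxE normrN. Qed.

Lemma enorm_ge0 a : 0 <= enorm a.
Proof. exact: sqrtr_ge0. Qed.

Lemma enorm_le_norm1 a : enorm a <= norm1 a.
Proof.
rewrite -[leRHS]ger0_norm ?norm1_ge0// -sqrtr_sqr ler_wsqrtr//.
(* Nonnegativity of the partial sums is carried through the induction to control the cross term of
   the square. *)
suff: 0 <= norm1 a /\ \sum_i a ord0 i ^+ 2 <= norm1 a ^+ 2 by case.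
rewrite /norm1; elim/big_rec2: _ => [|i y1 y2 _ [y0 h]]; first by rewrite expr0n.
split; first exact: addr_ge0.
rewrite -(real_normK (num_real (a ord0 i))).
have := normr_ge0 (a ord0 i); nra.
Qed.

Lemma coord_le_enorm a i : `|a ord0 i| <= enorm a.
Proof.
rewrite -sqrtr_sqr ler_wsqrtr// (bigD1 i)//= lerDl.
by apply: sumr_ge0 => j _; exact: sqr_ge0.
Qed.

Lemma norm1_le_enorm a : norm1 a <= n%:R * enorm a.
Proof.
rewrite -[n in n%:R]card_ord mulr_natl -sumr_const.
by apply: ler_sum => i _; exact: coord_le_enorm.
Qed.

Lemma norm1_continuous : continuous norm1.
Proof.
rewrite (_ : norm1 = \sum_i (fun a => `|a ord0 i|)); last first.
  by apply/funext => a; rewrite fct_sumE.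
elim/big_ind: _ => [|f g cf cg|i _].
- exact: cst_continuous.
- by move=> a; apply: continuousD; [exact: cf|exact: cg].
move=> a; apply: (@continuous_comp _ _ _ (fun a : 'rV[R]_n => a ord0 i) Num.norm).
  exact: coord_continuous.
exact: norm_continuous.
Qed.

(** Stated on arbitrary representatives, this avoids the infimum in [torus_dist] and lets segments
    of the covering space be followed. *)
Definition lip1 L f := forall a b, `|f (torus_pi a) - f (torus_pi b)| <= L * norm1 (a - b).

Lemma lip1W L K f : L <= K -> lip1 L f -> lip1 K f.
Proof.
move=> LK fL a b; apply: (le_trans (fL a b)).
by rewrite ler_wpM2r ?norm1_ge0.
Qed.

Lemma Lip_lip1 f : Lip f -> exists L, lip1 L f.
Proof.
(* [Lip] does not fix the sign of [L]; the absolute value makes multiplication monotone. *)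
move=> [L fL]; exists `|L| => a b; apply: (le_trans (fL _ _)).
have d0 : has_lbound [set r | exists c d : 'rV[R]_n,
    [/\ torus_pi c = torus_pi a, torus_pi d = torus_pi b & r = enorm (c - d)]].
  by exists 0 => _ [c [d [_ _ ->]]]; exact: enorm_ge0.
have le_d : torus_dist (torus_pi a) (torus_pi b) <= norm1 (a - b).
  apply: le_trans (enorm_le_norm1 _).
  by apply: ge_inf => //; exists a, b.
have ge_d : 0 <= torus_dist (torus_pi a) (torus_pi b).
  apply: lb_le_inf; first by exists (enorm (a - b)), a, b.
  by move=> _ [c [d [_ _ ->]]]; exact: enorm_ge0.
by apply: (le_trans (ler_wpM2r ge_d (ler_norm L))); exact: ler_wpM2l.
Qed.

Lemma lip1_Lip L f : 0 <= L -> lip1 L f -> Lip f.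
Proof.
(* The [+ 1] keeps [M] positive, so that dividing by it turns the goal into a lower bound of the
   infimum. *)
move=> L0 fL; pose M := L * n%:R + 1.
have M0 : 0 < M by rewrite ltr_wpDl// mulr_ge0.
exists M => x y; rewrite mulrC -ler_pdivrMr//; apply: lb_le_inf.
  by exists (enorm (repr x - repr y)), (repr x), (repr y); rewrite !reprK.
move=> _ [a [b [<- <- ->]]]; rewrite ler_pdivrMr//.
apply: (le_trans (fL a b)); rewrite mulrC mulrDr mulr1.
apply: (@le_trans _ _ (L * (n%:R * enorm (a - b)))).
  by rewrite mulrC ler_wpM2l// norm1_le_enorm.
by rewrite mulrCA mulrC mulrA (mulrC L) mulrAC lerDl enorm_ge0.
Qed.

Lemma lip1_continuous L f : 0 <= L -> lip1 L f -> continuous f.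
Proof.
move=> L0 fL; apply/torus_continuousP => a.
apply/(@cvgrPdist_le _ _ _ (nbhs a)) => e e0.
have c0 : {for a, continuous (fun b => norm1 (a - b))}.
  apply: continuous_comp; last exact: norm1_continuous.
  by apply: continuousB => //; exact: cst_continuous.
have M0 : 0 < L + 1 by rewrite ltr_wpDl.
have : \forall b \near a, norm1 (a - b) < e / (L + 1).
  apply: (@cvgr_lt _ _ (nbhs a) _ _ (norm1 (a - a)) c0); rewrite subrr.
  by rewrite /norm1 big1 ?divr_gt0// => i _; rewrite mxE normr0.
apply: filterS => b; rewrite ltr_pdivlMr// => /ltW h.
apply: (le_trans (fL a b)); apply: le_trans h.
by rewrite mulrC ler_wpM2l ?norm1_ge0// lerDl.
Qed.

Lemma segment_continuous {T : topologicalType} (f : torus R n -> T) a v :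
  continuous f -> continuous (fun t : R => f (torus_pi (a + t *: v))).
Proof.
move=> cf t; apply: continuous_comp; last exact: cf.
apply: continuous_comp; last exact: pi_continuous.
by apply: cvgD; [exact: cvg_cst|exact: scalel_continuous].
Qed.

(** Mean value theorem along the segment. The gradient bound is asked only at interior times,
    because in [lip1_max] it may fail at the contact point that ends the segment. *)
Lemma C1_segment_le g a v K s : C1 g -> 0 <= s ->
  (forall t : R, 0 < t < s -> forall i, `|torus_grad g (torus_pi (a + t *: v)) ord0 i| <= K) ->
  `|g (torus_pi (a + s *: v)) - g (torus_pi a)| <= K * (s * norm1 v).
Proof.
move=> g1 s0 gK.
have [s00|s_neq0] := eqVneq s 0.
  by rewrite s00 scale0r addr0 subrr normr0 mul0r mulr0.
have sp : 0 < s by rewrite lt_neqAle eq_sym s_neq0.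
pose F (t : R) := torus_lift g (a + t *: v).
have dF (t : R) : t \in `]0, s[%R -> is_derive t 1 F ('D_v (torus_lift g) (a + t *: v)).
  by move=> _; apply: is_derive_line; exact: g1.1.
have cF : {within `[0, s], continuous F}.
  by apply: continuous_subspaceT; apply: segment_continuous; exact: C1_continuous.
have [t] := MVT sp dF cF; rewrite in_itv/= => ts.
rewrite /F /torus_lift/= scale0r addr0 subr0 => ->.
rewrite derive_grad; last exact: g1.1.
rewrite normrM (ger0_norm s0) mulrCA mulrC ler_wpM2l//.
apply: (le_trans (ler_norm_sum _ _ _)); rewrite mulr_sumr.
apply: ler_sum => i _; rewrite normrM mulrC ler_wpM2r//.
by rewrite -torus_gradE; exact: gK.
Qed.

(* Follow the segment from [a] to [b] as long as [g] stays above [u]; from the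
   first time [g <= u] on, the Lipschitz bound of [u] takes over. *)
Lemma lip1_max K u g : continuous u -> lip1 K u -> C1 g ->
  (forall y, u y < g y -> forall i, `|torus_grad g y ord0 i| <= K) ->
  lip1 K (fun y => Num.max (u y) (g y)).
Proof.
move=> cu uK g1 gK.
pose w y := Num.max (u y) (g y).
suff hw a b : w (torus_pi a) - w (torus_pi b) <= K * norm1 (a - b).
  move=> a b; rewrite ler_norml; apply/andP; split; last exact: hw.
  by rewrite lerNl opprB -norm1N opprB; exact: hw.
have [ga|ga] := leP (g (torus_pi a)) (u (torus_pi a)).
  rewrite [w (torus_pi a)]/w max_l//.
  apply: le_trans (le_trans (ler_norm _) (uK a b)).
  by rewrite lerB// le_max lexx.
have wb1 : u (torus_pi b) <= w (torus_pi b) by rewrite le_max lexx.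
have wb2 : g (torus_pi b) <= w (torus_pi b) by rewrite le_max lexx orbT.
rewrite [w (torus_pi a)]/w (max_r (ltW ga)).
pose v := b - a; pose gam (t : R) := torus_pi (a + t *: v).
have gam1 : gam 1 = torus_pi b by rewrite /gam scale1r /v addrC subrK.
have -> : norm1 (a - b) = norm1 v by rewrite -norm1N opprB.
pose h (t : R) := g (gam t) - u (gam t).
have ch : continuous h.
  move=> t; apply: continuousB; first exact: segment_continuous (C1_continuous _ g1) _.
  exact: segment_continuous.
(* The contact times along the segment; this set is compact, so if nonempty it has a first element,
   found below by minimizing the identity. *)
pose S := `[0, 1]%classic `&` [set t | h t <= 0].
have hS (t : R) : 0 <= t -> t <= 1 -> ~ S t -> u (gam t) < g (gam t).
  move=> t0 t1 nSt; rewrite -subr_gt0; apply: contrapT => ht; apply: nSt.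
  by split; rewrite /= ?in_itv/= ?t0 ?t1// leNgt; apply/negP.
have [S0|S0] := pselect (S !=set0); last first.
  have gK1 (t : R) : 0 < t < 1 -> forall i, `|torus_grad g (gam t) ord0 i| <= K.
    move=> /andP[t0 t1]; apply/gK/hS; rewrite ?ltW// => St.
    by apply: S0; exists t.
  have := C1_segment_le g a v K 1 g1 ler01 gK1.
  rewrite -/(gam 1) gam1 mul1r ler_norml => /andP[+ _]; lra.
have cS : compact S.
  apply: compact_closedI; first exact: segment_compact.
  by apply: (@preimage_closed _ _ h [set r | r <= 0]) => [t _|]; [exact: ch|exact: closed_le].
have cid : {within S, continuous (fun t : R => t)}.
  by apply: continuous_subspaceT => t; exact: cvg_id.
have [s /set_mem[]] := compact_EVT_min S0 cS cid.
rewrite /= in_itv/= => /andP[s0 s1] hs smin.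
have gK1 (t : R) : 0 < t < s -> forall i, `|torus_grad g (gam t) ord0 i| <= K.
  move=> /andP[t0 ts]; apply/gK/hS; first exact: ltW.
    exact: le_trans (ltW ts) s1.
  by move=> St; have := smin t (mem_set St); rewrite leNgt ts.
have := C1_segment_le g a v K s g1 s0 gK1.
rewrite -/(gam s) ler_norml => /andP[g1s _].
have := uK (a + s *: v) b; rewrite -/(gam s) ler_norml => /andP[_].
(* The costs [K * (s * norm1 v)] before contact and [K * ((1 - s) * norm1 v)] after it add up to
   [K * norm1 v]. *)
have -> : norm1 (a + s *: v - b) = (1 - s) * norm1 v.
  have -> : a + s *: v - b = (s - 1) *: v.
    by rewrite scalerBl scale1r /v opprB addrA addrAC [in RHS]addrC addrA.
  rewrite /norm1 mulr_sumr; apply: eq_bigr => i _.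
  by rewrite mxE normrM distrC (@ger0_norm _ (1 - s)) ?subr_ge0.
move: hs wb1 g1s; rewrite /h subr_le0; lra.
Qed.

End Lipschitz.

(** * Strict test functions, suprema of subsolutions, and the bump construction *)

Section Perron.
Context {R : realType} {n : nat}.
Local Notation torus_pi := (\pi_(torus R n)).
Implicit Types (x y : torus R n) (f g u v : torus R n -> R) (L e : R).

(** A large multiple of the bump makes a local contact global and strict, without changing the
    gradient at [x], where the gradient of the bump vanishes. *)
Lemma strict_touch u f x : continuous u -> C1 f ->
  (\forall y \near x, u y - f y <= u x - f x) ->
  exists g, [/\ C1 g, g x = u x, torus_grad g x = torus_grad f x &
    forall y, u y <= g y - cosbump x y].
Proof.
move=> cu f1 fx.
have [e e0 he] := cosbump_nbhs _ _ fx.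
have [z hz] : exists z, forall y, u y - f y <= u z - f z.
  apply: torus_continuous_argmax => y.
  by apply: continuousB; [exact: cu|exact: C1_continuous].
pose B := (u z - f z) - (u x - f x).
have B0 : 0 <= B by rewrite subr_ge0.
(* Where the bump is at least [e], the multiple [B / e] absorbs the excess [B] of the global maximum
   over the value at [x]; the extra 1 leaves one bump for strictness. *)
pose M := B / e + 1.
exists (fun y => f y + M * cosbump x y + (u x - f x)); split.
- exact: (C1_comb f (cosbump x) M _ f1 (cosbump_C1 x)).
- by rewrite cosbumpxx mulr0 addr0 addrC subrK.
- rewrite (torus_grad_comb f (cosbump x) M _ x f1 (cosbump_C1 x)).
  by rewrite torus_grad_cosbump scaler0 addr0.
move=> y; have q0 := cosbump_ge0 x y.
have Be0 : 0 <= B / e by rewrite divr_ge0// ltW.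
have [qe|eq] := ltP (cosbump x y) e.
  have := he y qe; have := mulr_ge0 Be0 q0; rewrite /= /M; lra.
have : B <= B / e * cosbump x y.
  by rewrite -{1}[B](divfK (lt0r_neq0 e0)) ler_wpM2l.
have := hz y; rewrite /M /B; lra.
Qed.

Lemma strict_touch_below u f x : continuous u -> C1 f ->
  (\forall y \near x, u x - f x <= u y - f y) ->
  exists g, [/\ C1 g, g x = u x, torus_grad g x = torus_grad f x &
    forall y, g y + cosbump x y <= u y].
Proof.
move=> cu f1 fx.
have opp_C1 h : C1 h -> C1 (fun y => 0 + (- 1) * h y + 0).
  by move=> h1; exact: (C1_comb (fun=> 0) h (- 1) 0 (C1_cst 0) h1).
have opp_grad h z : C1 h ->
    torus_grad (fun y => 0 + (- 1) * h y + 0) z = - torus_grad h z.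
  move=> h1; rewrite (torus_grad_comb (fun=> 0) h (- 1) 0 z (C1_cst 0) h1).
  by rewrite torus_grad_cst add0r scaleN1r.
have [||g [g1 gx gg gle]] := @strict_touch (fun y => - u y) _ x _ (opp_C1 f f1).
- by move=> y; apply: continuousN; exact: cu.
- by apply: filterS fx => y /=; lra.
exists (fun y => 0 + (- 1) * g y + 0); split.
- exact: opp_C1.
- by rewrite gx; lra.
- by rewrite opp_grad// gg opp_grad// opprK.
by move=> y; have := gle y; lra.
Qed.

Context (H : torus R n -> R -> 'rV[R]_n -> R) (C c : R).
Context (H_continuous :
  continuous (fun z : torus R n * R * 'rV[R]_n => H z.1.1 z.1.2 z.2)).
Context (C_gt0 : 0 < C).
Context (H_lipschitz : forall x p r s, `|H x r p - H x s p| <= C * `|r - s|).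

Lemma H_C1_continuous f : C1 f -> continuous (fun y => H y (f y) (torus_grad f y)).
Proof.
move=> f1 y.
apply: (@continuous_comp _ _ _ (fun z => (z, f z, torus_grad f z))
  (fun z : torus R n * R * 'rV[R]_n => H z.1.1 z.1.2 z.2)); last exact: H_continuous.
have cf : f z @[z --> y] --> f y := C1_continuous _ f1 y.
have cg : torus_grad f z @[z --> y] --> torus_grad f y := torus_grad_continuous _ f1 y.
exact: (cvg_pair (cvg_pair cvg_id cf) cg).
Qed.

(** A member [v] nearly attaining [u x] has its contact point [y] with the strict test function [g]
    near [x], and [v y] near [g y]. If the inequality failed for [g] at [x], it would then fail for
    [v] at [y]. *)
Lemma subsolution_sup (F : set (torus R n -> R)) u :
  (forall v, F v -> viscosity_subsolution H c v) ->
  (forall v, F v -> forall x, v x <= u x) ->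
  (forall x e, 0 < e -> exists2 v, F v & u x - e < v x) ->
  continuous u -> viscosity_subsolution H c u.
Proof.
move=> Fsub Fle Fsup cu; split=> // f x f1 fx.
have [g [g1 gx <- ug]] := strict_touch _ _ _ cu f1 fx.
rewrite -gx leNgt; apply/negP => Hc.
pose eta := (H x (g x) (torus_grad g x) - c) / 2.
have eta0 : 0 < eta by rewrite divr_gt0 ?subr_gt0.
have : \forall y \near x, c + eta < H y (g y) (torus_grad g y).
  apply: (@cvgr_gt _ _ (nbhs x) _ _ _ (H_C1_continuous _ g1 x)).
  by rewrite /eta; lra.
move=> /(cosbump_nbhs x)[e1 e10 he1].
(* [e1] keeps [y] where the strict inequality holds; [eta / C] makes replacing [g y] by [v y] in [H]
   cost at most [eta]. *)
pose e := Num.min e1 (eta / C).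
have e0 : 0 < e by rewrite lt_min e10 divr_gt0.
have [v Fv vx] := Fsup x e e0.
have cv := (Fsub v Fv).1.
have [y hy] : exists y, forall z, v z - g z <= v y - g y.
  apply: torus_continuous_argmax => z.
  by apply: continuousB; [exact: cv|exact: C1_continuous].
have vg : v y - g y > - e by have := hy x; rewrite gx; lra.
have vu : v y <= g y - cosbump x y := le_trans (Fle v Fv y) (ug y).
have q0 := cosbump_ge0 x y.
have /he1/= : cosbump x y < e1.
  by apply: (@lt_le_trans _ _ e); [lra|rewrite ge_min lexx].
have : H y (v y) (torus_grad g y) <= c.
  by apply: (Fsub v Fv).2 => //; apply: (@nearW _ (nbhs y)) => z; exact: hy.
have := H_lipschitz y (torus_grad g y) (g y) (v y).
have : C * `|g y - v y| <= eta.
  rewrite mulrC -ler_pdivlMr// (@le_trans _ _ e)//; last first.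
    by rewrite ge_min lexx orbT.
  by rewrite ler_norml; apply/andP; split; lra.
rewrite ler_norml => h1 /andP[_]; lra.
Qed.

Lemma subsolution_bump u phi f x L :
  viscosity_subsolution H c u -> continuous phi -> lip1 L u ->
  (forall y, u y <= phi y) -> u x < phi x ->
  C1 f -> (\forall y \near x, u x - f x <= u y - f y) ->
  H x (u x) (torus_grad f x) < c ->
  (forall i, `|torus_grad f x ord0 i| < L) ->
  exists w, [/\ viscosity_subsolution H c w, lip1 L w,
    forall y, u y <= w y <= phi y & u x < w x].
Proof.
move=> usub cphi uL uphi uphix f1 fx Hfx fL; have cu := usub.1.
have [g [g1 gx gf gu]] := strict_touch_below _ _ _ cu f1 fx.
rewrite -gx -gf in uphix Hfx; rewrite -gf in fL.
pose eta := (c - H x (g x) (torus_grad g x)) / 2.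
have eta0 : 0 < eta by rewrite divr_gt0 ?subr_gt0.
pose d := (phi x - g x) / 2.
have d0 : 0 < d by rewrite divr_gt0 ?subr_gt0.
have near1 : \forall y \near x, H y (g y) (torus_grad g y) < c - eta.
  apply: (@cvgr_lt _ _ (nbhs x) _ _ _ (H_C1_continuous _ g1 x)).
  by rewrite /eta; lra.
have near2 : \forall y \near x, d < phi y - g y.
  have cpg : {for x, continuous (fun y => phi y - g y)}.
    by apply: continuousB; [exact: cphi|exact: C1_continuous].
  by apply: (@cvgr_gt _ _ (nbhs x) _ _ _ cpg); rewrite /d; lra.
have near3 : \forall y \near x, forall i, `|torus_grad g y ord0 i| < L.
  apply: (@filter_forall _ _ _ (nbhs x)) => i.
  have cgi : {for x, continuous (fun y => `|torus_grad g y ord0 i|)}.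
    apply: (@continuous_comp _ _ _ (fun y => torus_grad g y ord0 i) Num.norm).
      apply: (@continuous_comp _ _ _ (torus_grad g) (fun p : 'rV[R]_n => p ord0 i)).
        exact: torus_grad_continuous.
      exact: coord_continuous.
    exact: norm_continuous.
  exact: (@cvgr_lt _ _ (nbhs x) _ _ _ cgi).
have [e e0 he] := cosbump_nbhs _ _ (filterI near1 (filterI near2 near3)).
(* [e] confines the set where [G] exceeds [u] to the good neighbourhood, [d] keeps [G] below [phi],
   and [eta / C] bounds by [eta] the change of [H] under the lift. *)
pose del := Num.min e (Num.min d (eta / C)).
have del0 : 0 < del by rewrite !lt_min e0 d0 divr_gt0.
have dele : del <= e by rewrite ge_min lexx.
have deld : del <= d by rewrite !ge_min lexx orbT.
have delC : del * C <= eta by rewrite -ler_pdivlMr// !ge_min lexx !orbT.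
(* The vanishing middle term puts [G] in the shape required by [C1_comb]. *)
pose G y := g y + 0 * 0 + del.
have G1 : C1 G by exact: (C1_comb g (fun=> 0) 0 del g1 (C1_cst 0)).
have gG y : torus_grad G y = torus_grad g y.
  rewrite (torus_grad_comb g (fun=> 0) 0 del y g1 (C1_cst 0)).
  by rewrite scale0r addr0.
have uG y : u y < G y -> [/\ H y (g y) (torus_grad g y) < c - eta,
    d < phi y - g y & forall i, `|torus_grad g y ord0 i| < L].
  by move=> uGy; have [|? []//] := he y; have := gu y; move: uGy; rewrite /G; lra.
exists (fun y => Num.max (u y) (G y)); split.
- split=> [y|h y h1 hy].
    by apply: continuous_max; [exact: cu|exact: C1_continuous].
  (* Touching the maximum from above at [y] means touching whichever of [u] and [G] attains it; for
     [G], the gradients of the two C1 functions must agree. *)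
  have [Gu|uGy] := leP (G y) (u y).
    apply: usub.2 => //; apply: filterS hy => z /=.
    rewrite (max_l Gu); apply: le_trans; apply: lerB => //.
    by rewrite le_max lexx.
  have [HG _ _] := uG y uGy.
  have -> : torus_grad h y = torus_grad g y.
    rewrite -gG; apply/esym/torus_grad_touch => //; apply: filterS hy => z /=.
    rewrite (max_r (ltW uGy)); apply: le_trans; apply: lerB => //.
    by rewrite le_max lexx orbT.
  have := H_lipschitz y (torus_grad g y) (G y) (g y).
  have -> : G y - g y = del by rewrite /G; lra.
  rewrite (gtr0_norm del0) ler_norml => /andP[_]; lra.
- by apply: lip1_max => // y /uG[_ _ h] i; rewrite gG ltW.
- move=> y; rewrite le_max lexx/= ge_max uphi/=.
  have [Gu|uGy] := leP (G y) (u y); first exact: le_trans (uphi y).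
  by have [_ + _] := uG y uGy; rewrite /G; lra.
by rewrite lt_max -gx /G; apply/orP; right; lra.
Qed.

End Perron.

Theorem theorem1p1 (R : realType) (n : nat)
  (H : torus R n -> R -> 'rV[R]_n -> R)
  (H_continuous :
    continuous (fun z : torus R n * R * 'rV[R]_n => H z.1.1 z.1.2 z.2))
  (H_lipschitz : exists2 C_1 : R, 0 < C_1 &
    forall (x : torus R n) (p : 'rV[R]_n) (r s : R),
      `|H x r p - H x s p| <= C_1 * `|r - s|)
  (H_coercive : forall M : R, exists K : R,
    forall (x : torus R n) (p : 'rV[R]_n), K <= enorm p -> M <= H x 0 p)
  (c : R) (psi phi : torus R n -> R)
  (psi_Lip : Lip psi) (phi_Lip : Lip phi)
  (psi_le_phi : forall x, psi x <= phi x)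
  (psi_sub : viscosity_subsolution H c psi)
  (phi_super : viscosity_supersolution H c phi) :
  exists2 u : torus R n -> R, Lip u & viscosity_solution H c u.
Proof.
have [C C0 HC] := H_lipschitz.
have [cpsi cphi] := (psi_sub.1, phi_super.1).
have [B hB] : exists B, forall x r, psi x <= r <= phi x -> `|r| <= B.
  have [x1 h1] := torus_continuous_argmax _ cphi.
  have [|x2 h2] := @torus_continuous_argmax _ _ (fun x => - psi x).
    by move=> x; apply: continuousN; exact: cpsi.
  exists (`|phi x1| + `|psi x2|) => x r /andP[r1 r2]; rewrite ler_norml.
  have := h1 x; have := h2 x; have := ler_norm (phi x1); have := ler_norm (- psi x2).
  have := normr_ge0 (phi x1); have := normr_ge0 (psi x2); rewrite normrN.
  by move=> *; apply/andP; split; lra.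
(* [C * B] bounds the cost of replacing [r] by 0 in [H], since coercivity is known only at
   [r = 0]. *)
have [K hK] := H_coercive (c + C * B).
have grad_lt x r p i : psi x <= r <= phi x -> H x r p < c -> `|p ord0 i| < K.
  move=> /hB rB Hr; apply: (le_lt_trans (coord_le_enorm p i)).
  rewrite ltNge; apply/negP => /hK - /(_ x).
  have := HC x p r 0; rewrite subr0 ler_norml => /andP[+ _].
  by have := ler_wpM2l (ltW C0) rB; lra.
have [L0 psiL0] := Lip_lip1 _ psi_Lip.
(* Large enough for [psi] to be admissible and for [K] to bound the gradients; the absolute values
   also make it nonnegative. *)
pose L := `|L0| + `|K|.
have L_ge0 : 0 <= L by exact: addr_ge0.
have KL : K <= L by apply: (le_trans (ler_norm K)); rewrite lerDr.
have psiL : lip1 L psi.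
  by apply: (lip1W _ _ _ _ psiL0); apply: (le_trans (ler_norm _)); rewrite lerDl.
pose F := [set v | [/\ viscosity_subsolution H c v, lip1 L v &
  forall x, psi x <= v x <= phi x]].
have Fpsi : F psi by split=> // x; rewrite lexx psi_le_phi.
pose E x := [set v x | v in F].
pose u x := sup (E x).
(* [sup] is meaningful only for nonempty bounded sets: [psi] provides a member and [phi] a bound. *)
have E_sup x : has_sup (E x).
  split; first by exists (psi x), psi.
  by exists (phi x) => _ [v [_ _ vb] <-]; have /andP[] := vb x.
have F_le v : F v -> forall x, v x <= u x.
  by move=> Fv x; apply: sup_upper_bound => //; exists v.
have u_le x M : (forall v, F v -> v x <= M) -> u x <= M.
  move=> hM; apply: ge_sup; first exact: (E_sup x).1.
  by move=> _ [v Fv <-]; exact: hM.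
have u_b x : psi x <= u x <= phi x.
  rewrite (F_le _ Fpsi)/=; apply: u_le => v [_ _ vb].
  by have /andP[] := vb x.
have uL : lip1 L u.
  have hu a b : u (\pi_(torus R n) a) - u (\pi_(torus R n) b) <= L * norm1 (a - b).
    rewrite lerBlDr; apply: u_le => v Fv; have [_ vL _] := Fv.
    have := vL a b; rewrite ler_norml => /andP[_].
    by have := F_le v Fv (\pi_(torus R n) b); lra.
  move=> a b; rewrite ler_norml hu andbT lerNl opprB -norm1N opprB; exact: hu.
have cu : continuous u := lip1_continuous _ _ L_ge0 uL.
have u_sub : viscosity_subsolution H c u.
  apply: (@subsolution_sup _ _ H C c H_continuous C0 HC F) => //.
    by move=> v [].
  move=> x e e0; have [_ [v Fv <-] vx] := sup_adherent e0 (E_sup x).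
  by exists v.
exists u; first exact: (lip1_Lip _ _ L_ge0 uL).
split=> //; split=> // f x f1 fx; rewrite leNgt; apply/negP => Hx.
have /andP[_] := u_b x; rewrite le_eqVlt => /orP[/eqP ux|ux].
  (* At a contact point, a test function touching [u] from below also touches [phi] from below,
     because [u] stays under [phi]. *)
  move: Hx; rewrite ux ltNge => /negP; apply; apply: phi_super.2 => //.
  apply: filterS fx => y; rewrite ux => /le_trans; apply.
  by rewrite lerB//; have /andP[] := u_b y.
have uphi y : u y <= phi y by have /andP[] := u_b y.
have fL i : `|torus_grad f x ord0 i| < L.
  by apply: lt_le_trans KL; exact: grad_lt (u_b x) Hx.
have [w [w_sub wL w_b]] :=
  @subsolution_bump _ _ H C c H_continuous C0 HC u phi f x L u_sub cphi uL uphi ux f1 fx Hx fL.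
(* The bumped function [w] belongs to [F], so [w x <= u x], against [u x < w x]. *)
rewrite ltNge => /negP; apply; apply: F_le; split=> // y.
have /andP[uw ->] := w_b y; rewrite andbT.
by apply: le_trans uw; have /andP[] := u_b y.
Qed.
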